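(* Assume $\kappa>0$, $\phi_*:=\inf_{r\ge0}\phi(r)>0$ and $\phi_*M>\sigma\bar\theta$. Then for every solution of system (CSF), $\mathcal A(t):=\max_{i,j}|\mathbf v_i(t)-\mathbf v_j(t)|\to0$ exponentially fast, and exactly one of the following holds: either $\mathbf v_i(t)\to0$ for all $i$, or there exists a vector $\bar{\mathbf v}\in\mathbb R^n$ with $|\bar{\mathbf v}|=\bar\theta^{1/p}$ such that all $\mathbf v_i(t)$ converge to $\bar{\mathbf v}$ exponentially fast.
   Context: Fix integers $N\ge1$, $n\ge1$, masses $m_1,\dots,m_N>0$ with $M=\sum_i m_i$, parameters $\sigma>0$, $p>0$, $\kappa\ge0$, and a communication kernel $\phi:[0,\infty)\to(0,\infty)$ that is smooth, positive and non-increasing. Write $\phi_{ij}=\phi(|\mathbf x_i-\mathbf x_j|)$, with $|\cdot|$ the Euclidean norm on $\mathbb R^n$. System (CSF) is, for $i=1,\dots,N$, $$\dot{\mathbf x}_i=\mathbf v_i,\qquad \dot{\mathbf v}_i=\sum_{j=1}^N m_j\phi_{ij}(\mathbf v_j-\mathbf v_i)+\sigma(\theta_i-|\mathbf v_i|^p)\mathbf v_i,\qquad \dot\theta_i=\kappa\sum_{j=1}^N m_j\phi_{ij}(\theta_j-\theta_i),$$ with $\mathbf x_i,\mathbf v_i\in\mathbb R^n$ and initial values $\theta_i(0)>0$; solutions are considered for $t\ge0$. Set $\bar\theta=\frac1M\sum_i m_i\theta_i(0)$; this weighted average is conserved in time. *)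

(* Defs.v *)
From HB Require Import structures.
From mathcomp Require Import all_boot all_order all_algebra.
From mathcomp Require Import all_classical all_reals all_analysis.
Set Implicit Arguments. Unset Strict Implicit. Unset Printing Implicit Defensive.
Import Order.TTheory GRing.Theory Num.Theory.
Import numFieldNormedType.Exports.
Local Open Scope ring_scope.
Local Open Scope classical_set_scope.

Section CSF.
Variable R : realType.

(* Euclidean norm on R^n (MathComp's built-in norm on 'rV is the sup norm). *)
Definition enorm (n : nat) (w : 'rV[R]_n) : R :=
  Num.sqrt (\sum_(k < n) w ord0 k ^+ 2).

(* phi : R -> R is C^infinity (a smooth kernel on [0,oo) is the restriction of
   a smooth function on R; only its values on [0,oo) enter the system). *)
Definition smooth (f : R -> R) : Prop :=
  forall (k : nat) (r : R), derivable (derive1n k f) r 1.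

Definition CSF_solution (N n : nat) (m : 'I_N -> R) (sigma p kappa : R)
    (phi : R -> R) (x v : 'I_N -> R -> 'rV[R]_n) (theta : 'I_N -> R -> R) : Prop :=
  forall (t : R), 0 <= t -> forall i : 'I_N,
    [/\ is_derive t 1 (x i) (v i t),
        is_derive t 1 (v i)
          (\sum_(j < N) (m j * phi (enorm (x i t - x j t))) *: (v j t - v i t)
           + (sigma * (theta i t - enorm (v i t) `^ p)) *: v i t)
      & is_derive t 1 (theta i)
          (kappa * \sum_(j < N) m j * phi (enorm (x i t - x j t)) * (theta j t - theta i t))].

Definition total_mass (N : nat) (m : 'I_N -> R) : R := \sum_(i < N) m i.

Definition theta_bar (N : nat) (m : 'I_N -> R) (theta : 'I_N -> R -> R) : R :=
  (\sum_(i < N) m i * theta i 0) / total_mass m.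

Definition vel_diam (N n : nat) (v : 'I_N -> R -> 'rV[R]_n) (t : R) : R :=
  \big[Num.max/0]_(i < N) \big[Num.max/0]_(j < N) enorm (v i t - v j t).

Definition exp_decay (f : R -> R) : Prop :=
  exists C c : R, 0 < c /\ forall t, 0 <= t -> f t <= C * expR (- (c * t)).

End CSF.

(* Main.v *)
(* The weighted variances of the theta_i and of the v_i are Lyapunov functions:
   consensus contracts them at rates kappa phi_* M and phi_* M. The first gives
   theta_i -> theta_bar exponentially. In the second, the friction |v|^p v is
   monotone and helps, while the growth rate sigma theta_i is eventually below
   phi_* M up to an exponentially small error; so the v_i align.
   Fix one particle, with r = |v_0|^2. Alignment turns its equation into
   r' = 2 sigma (theta_bar - r^(p/2)) r + (exponentially small). If r does not
   tend to 0, it is at some late time above a level eps < theta_bar^(2/p); since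
   r' > 0 on that level it stays above it, and there the equation is
   exponentially contracting towards theta_bar^(2/p). Then v_0' is
   exponentially small, so v_0 converges, and so do all v_i. *)
Require Import Defs.
From HB Require Import structures.
From mathcomp Require Import all_boot all_order all_algebra.
From mathcomp Require Import all_classical all_reals all_analysis.
From mathcomp Require Import ring lra.
Import Order.TTheory GRing.Theory Num.Theory.
Import numFieldNormedType.Exports.
Local Open Scope ring_scope.
Local Open Scope classical_set_scope.

Set Implicit Arguments.
Unset Strict Implicit.
Unset Printing Implicit Defensive.

(** * Real calculus: Gronwall, convergence from a decaying derivative, trapping, powers *)

Section Calculus.
Variable R : realType.
Implicit Types (f g : R -> R) (t : R).

Lemma is_derive_add f g t df dg : is_derive t 1 f df -> is_derive t 1 g dg ->
  is_derive t 1 (fun s => f s + g s) (df + dg).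
Proof. by move=> ? ?; exact: is_deriveD. Qed.

Lemma is_derive_sub f g t df dg : is_derive t 1 f df -> is_derive t 1 g dg ->
  is_derive t 1 (fun s => f s - g s) (df - dg).
Proof. by move=> ? ?; exact: is_deriveB. Qed.

Lemma is_derive_mul f g t df dg : is_derive t 1 f df -> is_derive t 1 g dg ->
  is_derive t 1 (fun s => f s * g s) (df * g t + f t * dg).
Proof.
move=> ? ?; apply: (is_derive_eq (is_deriveM _ _)).
by rewrite addrC /GRing.scale /= (mulrC (g t)).
Qed.

Lemma is_derive_scal (a : R) f t df : is_derive t 1 f df ->
  is_derive t 1 (fun s => a * f s) (a * df).
Proof. by move=> ?; exact: is_deriveZ. Qed.

Lemma is_derive_sqr f t df : is_derive t 1 f df ->
  is_derive t 1 (fun s => f s ^+ 2) (2 * f t * df).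
Proof.
move=> h; have := is_derive_mul h h.
by rewrite (_ : df * _ + _ = 2 * f t * df); [under eq_fun do rewrite -expr2 | ring].
Qed.

Lemma is_derive_bigsum (N : nat) (f : 'I_N -> R -> R) (df : 'I_N -> R) t :
  (forall i, is_derive t 1 (f i) (df i)) ->
  is_derive t 1 (fun s => \sum_(i < N) f i s) (\sum_(i < N) df i).
Proof.
move=> h; have := is_derive_sum h.
by congr (is_derive _ _ _ _); apply/funext => s; rewrite fct_sumE.
Qed.

Lemma is_derive_expRM (a t : R) :
  is_derive t 1 (fun s => expR (a * s)) (a * expR (a * t)).
Proof.
have h : is_derive t 1 (fun s => a * s) a.
  by apply: (is_derive_eq (is_derive_scal a (is_derive_id t 1))); rewrite mulr1.
have := @is_derive1_comp R expR (fun s => a * s) t _ _ (is_derive_expR _) h.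
by rewrite mulrC.
Qed.

Lemma is_derive_coord n (u : R -> 'rV[R]_n) (du : 'rV[R]_n) t k :
  is_derive t 1 u du -> is_derive t 1 (fun s => u s ord0 k) (du ord0 k).
Proof.
move=> [du1 du2]; split; first exact: (derivable_mxP _ _ _).1.
by rewrite -du2 derive_mx// mxE.
Qed.

Lemma is_derive_continuous f df t : is_derive t 1 f df -> {for t, continuous f}.
Proof.
by move=> [h _]; apply/differentiable_continuous/derivable1_diffP.
Qed.

Lemma nonincreasing_from f df (T s t : R) :
  (forall r, T <= r -> is_derive r 1 f (df r)) ->
  (forall r, T <= r -> df r <= 0) -> T <= s -> s <= t -> f t <= f s.
Proof.
move=> hd hn Ts st.
have [||c ct /eqP] := @MVT_segment R f df s t st.
- by move=> x /[!in_itv]/= /andP[sx _]; apply: hd; lra.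
- apply: continuous_in_subspaceT => x /[!inE]/=.
  by rewrite in_itv /= => /andP[sx _]; apply: (is_derive_continuous (hd x _)); lra.
rewrite subr_eq => /eqP ->.
move: ct; rewrite in_itv /= => /andP[sc ct].
have := hn c (le_trans Ts sc); nra.
Qed.

(* The barrier [K * expR (- d * t)] with [d < a] absorbs the forcing term. *)
Lemma gronwall_from f df (a c C T : R) : 0 <= T -> 0 < a -> 0 < c -> 0 <= C ->
  (forall t, T <= t -> is_derive t 1 f (df t)) ->
  (forall t, T <= t -> df t <= - a * f t + C * expR (- (c * t))) ->
  exists C' c', [/\ 0 <= C', 0 < c' &
    forall t, T <= t -> f t <= C' * expR (- (c' * t))].
Proof.
move=> T0 a0 c0 C0 hd hle.
pose d := Num.min (a / 2) c.
have d0 : 0 < d by rewrite lt_min c0 andbT; lra.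
have da : d <= a / 2 by rewrite ge_min lexx.
have dc : d <= c by rewrite ge_min lexx orbT.
pose K := C / (a - d).
have K0 : 0 <= K by apply: divr_ge0 => //; lra.
have Kad : K * (a - d) = C by rewrite /K divfK//; apply/eqP; lra.
(* The excess of [f] over the barrier times the integrating factor [expR (a * t)]; [K * (a - d) = C]
   is what makes it nonincreasing. *)
pose h t := (f t - K * expR (- d * t)) * expR (a * t).
pose dh t := (df t - K * (- d * expR (- d * t))) * expR (a * t)
  + (f t - K * expR (- d * t)) * (a * expR (a * t)).
have hh t : T <= t -> is_derive t 1 h (dh t).
  move=> Tt; apply: is_derive_mul; last exact: is_derive_expRM.
  by apply: is_derive_sub; [exact: hd|apply/is_derive_scal/is_derive_expRM].
have hh0 t : T <= t -> dh t <= 0.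
  move=> Tt.
  have -> : dh t = (df t + a * f t - K * (a - d) * expR (- d * t)) * expR (a * t).
    by rewrite /dh; ring.
  rewrite Kad pmulr_lle0 ?expR_gt0//.
  have e1 : expR (- (c * t)) <= expR (- d * t) by rewrite ler_expR; nra.
  by have := hle t Tt; nra.
exists (K + `|h T|), d; split => // [|t Tt]; first exact: addr_ge0.
have ht := nonincreasing_from hh hh0 (lexx T) Tt.
have -> : f t = K * expR (- (d * t)) + h t * expR (- (a * t)).
  by rewrite /h -mulrA -expRD mulNr subrr expR0; ring.
rewrite mulrDl lerD2l; apply: (@le_trans _ _ (`|h T| * expR (- (a * t)))).
  by rewrite ler_wpM2r ?expR_ge0// (le_trans ht)// ler_norm.
by rewrite ler_wpM2l// ler_expR; nra.
Qed.

(** With [e] the tail integral of the bound on the derivative, [f + e] is nonincreasing and [f - e]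
    nondecreasing. Every lower value lies below every upper one, so the supremum of the lower
    envelope is within [e t] of [f t]. *)
Lemma cvg_of_expR_derivative f df (c C : R) : 0 < c ->
  (forall t, 0 <= t -> is_derive t 1 f (df t)) ->
  (forall t, 0 <= t -> `|df t| <= C * expR (- (c * t))) ->
  exists l, forall t, 0 <= t -> `|f t - l| <= C / c * expR (- (c * t)).
Proof.
move=> c0 hd hle; pose e t := C / c * expR (- c * t).
have he t : is_derive t 1 e (- (C * expR (- (c * t)))).
  apply: (is_derive_eq (is_derive_scal (C / c) (is_derive_expRM (- c) t))).
  by rewrite mulrA mulrN divfK ?gt_eqF// mulNr mulNr.
have up s t : 0 <= s -> s <= t -> f t + e t <= f s + e s.
  move=> s0 st; apply: (@nonincreasing_from (fun r => f r + e r)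
    (fun r => df r - C * expR (- (c * r))) _ _ _ _ _ s0 st) => r r0.
    exact: is_derive_add (hd r r0) (he r).
  by have := hle r r0; rewrite ler_norml; lra.
have dn s t : 0 <= s -> s <= t -> e t - f t <= e s - f s.
  move=> s0 st; apply: (@nonincreasing_from (fun r => e r - f r)
    (fun r => - (C * expR (- (c * r))) - df r) _ _ _ _ _ s0 st) => r r0.
    exact: is_derive_sub (he r) (hd r r0).
  by have := hle r r0; rewrite ler_norml; lra.
have C0 : 0 <= C.
  have := le_trans (normr_ge0 _) (hle 0 (lexx _)).
  by rewrite mulr0 oppr0 expR0 mulr1.
have e0 t : 0 <= e t by rewrite mulr_ge0 ?expR_ge0// divr_ge0// ltW.
have cross s t : 0 <= s -> 0 <= t -> f s - e s <= f t + e t.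
  move=> s0 t0; case: (lerP s t) => [st|/ltW ts].
    by have := dn _ _ s0 st; have := e0 t; lra.
  by have := up _ _ t0 ts; have := e0 s; lra.
pose A := (fun s => f s - e s) @` [set s | 0 <= s].
have A0 : A !=set0 by exists (f 0 - e 0), 0 => //=.
exists (sup A) => t t0; rewrite -mulNr -/(e t) ler_norml.
have h1 : f t - e t <= sup A.
  apply: ub_le_sup; last by exists t.
  by exists (f 0 + e 0) => _ [s s0 <-]; exact: cross.
have h2 : sup A <= f t + e t.
  by apply: ge_sup => // _ [s s0 <-]; exact: cross.
by lra.
Qed.

(** If [f] is below [eps] at [t1], consider the last earlier time [s0] with [eps <= f]. Continuity
    gives [f s0 = eps], and the positive derivative there pushes [f] above [eps] just after [s0],
    against the choice of [s0]. *)
Lemma positivity_trap f df (eps T : R) :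
  (forall t, T <= t -> is_derive t 1 f (df t)) ->
  (forall t, T <= t -> f t = eps -> 0 < df t) ->
  eps <= f T -> forall t, T <= t -> eps <= f t.
Proof.
move=> hd hpos fT t1 Tt1; rewrite leNgt; apply/negP => ft1.
pose S := [set s | T <= s <= t1 /\ eps <= f s].
have hasS : has_sup S.
  split; first by exists T; split; rewrite ?lexx.
  by exists t1 => s [/andP[]].
have TS : T <= sup S by apply: ub_le_sup; [exact: hasS.2|split; rewrite ?lexx].
have St1 : sup S <= t1 by apply: ge_sup; [exact: hasS.1|move=> s [/andP[]]].
set s0 := sup S in TS St1.
have cf := is_derive_continuous (hd _ TS).
have fs0 : eps <= f s0.
  rewrite leNgt; apply/negP => fs0.
  have /cvgr_lt/(_ _ fs0) [d /= d0 hdd] := cf.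
  have [s Ss sd] := sup_adherent d0 hasS.
  have ss0 : s <= s0 by apply: ub_le_sup => //; exact: hasS.2.
  have := hdd s; rewrite /ball_/= ger0_norm; last by lra.
  by move=> /(_ ltac:(rewrite -/s0 in sd; lra)); case: Ss => _; lra.
have s0t1 : s0 < t1.
  by rewrite lt_neqAle St1 andbT; apply: contraTneq ft1 => <-; rewrite -leNgt.
have above s : s0 < s -> s <= t1 -> f s < eps.
  move=> s0s st1; rewrite ltNge; apply/negP => fs.
  have : s <= s0.
    by apply: ub_le_sup; [exact: hasS.2|split => //; rewrite st1 andbT; lra].
  by lra.
have fs0e : f s0 = eps.
  apply/eqP; rewrite eq_le fs0 andbT leNgt; apply/negP => lt0.
  have /cvgr_gt/(_ _ lt0) [d /= d0 hdd] := cf.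
  pose s := Num.min t1 (s0 + d / 2).
  have s0s : s0 < s by rewrite lt_min s0t1; lra.
  have sd : s <= s0 + d / 2 by rewrite ge_min lexx orbT.
  have := hdd s; rewrite /ball_/= ltr0_norm; last by lra.
  move=> /(_ ltac:(lra)).
  by have := above s s0s; rewrite ge_min lexx => /(_ isT); lra.
have [+ hval] := hd _ TS.
have := hpos _ TS fs0e; rewrite -hval => dpos dd.
have /cvgr_gt/(_ _ dpos) [d /= d0 hdd] := dd.
(* A step short enough for the difference quotient to be positive and for [h + s0] not to pass
   [t1]. *)
pose h := Num.min (t1 - s0) (d / 2).
have h0 : 0 < h by rewrite lt_min; apply/andP; split; lra.
have hd2 : h <= d / 2 by rewrite ge_min lexx orbT.
have ht1 : h <= t1 - s0 by rewrite ge_min lexx.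
have := hdd h; rewrite /ball_/= sub0r normrN gtr0_norm// => /(_ ltac:(lra)).
rewrite gt_eqF// => /(_ isT).
rewrite /GRing.scale/= mulr1 pmulr_rgt0 ?invr_gt0//.
by have := above (h + s0); rewrite fs0e; lra.
Qed.

(* Tangent lines of [expR] compare [t `^ q - s `^ q] with
   [ln t - ln s], and those of [ln] compare the latter with [t - s]. *)
Lemma powR_bilipschitz (q a b s t : R) : 0 < q -> 0 < a ->
  a <= s -> s <= t -> t <= b ->
  q * a `^ q / b * (t - s) <= t `^ q - s `^ q /\
  t `^ q - s `^ q <= q * b `^ q / a * (t - s).
Proof.
move=> q0 a0 as_ st tb.
have s0 : 0 < s by lra.
have t0 : 0 < t by lra.
have b0 : 0 < b by lra.
have pw x : 0 < x -> x `^ q = expR (q * ln x) by move=> x0; rewrite /powR gt_eqF.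
have l1 : ln t - ln s <= (t - s) / s.
  rewrite -ln_div//; have := @le_ln1Dx R (t / s - 1).
  rewrite addrCA subrr addr0 mulrBl divff ?gt_eqF//; apply.
  by rewrite ltrBrDl subrr divr_gt0.
have l2 : (t - s) / t <= ln t - ln s.
  rewrite -[_ - ln s]opprB -ln_div//; have := @le_ln1Dx R (s / t - 1).
  rewrite addrCA subrr addr0 mulrBl divff ?gt_eqF// => h.
  have : -1 < s / t - 1 by rewrite ltrBrDl subrr divr_gt0.
  by move=> /h; lra.
have e1 : s `^ q * (q * (ln t - ln s)) <= t `^ q - s `^ q.
  have := expR_ge1Dx (q * (ln t - ln s)).
  have -> : t `^ q = s `^ q * expR (q * (ln t - ln s)).
    by rewrite !pw// -expRD; congr expR; ring.
  by have := powR_gt0 q s0; nra.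
have e2 : t `^ q - s `^ q <= t `^ q * (q * (ln t - ln s)).
  have := expR_ge1Dx (- (q * (ln t - ln s))).
  have -> : s `^ q = t `^ q * expR (- (q * (ln t - ln s))).
    by rewrite !pw// -expRD; congr expR; ring.
  by have := powR_gt0 q t0; nra.
have m1 : a `^ q <= s `^ q by rewrite ge0_ler_powR ?nnegrE//; lra.
have m2 : t `^ q <= b `^ q by rewrite ge0_ler_powR ?nnegrE//; lra.
have pa := powR_gt0 q a0; have ps := powR_gt0 q s0; have pt := powR_gt0 q t0.
split.
- apply: le_trans e1.
  rewrite (_ : _ / b * _ = a `^ q * (q * ((t - s) / b))); last by ring.
  rewrite ler_pM//; [by rewrite ltW| |].
    by rewrite mulr_ge0 ?(ltW q0)// divr_ge0//; lra.
  rewrite ler_pM2l//; apply: le_trans l2; rewrite ler_wpM2l ?subr_ge0//.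
  by rewrite lef_pV2.
- apply: (le_trans e2).
  rewrite (_ : _ / a * _ = b `^ q * (q * ((t - s) / a))); last by ring.
  rewrite ler_pM//; [by rewrite ltW| |].
    by rewrite mulr_ge0 ?(ltW q0)// (le_trans _ l2)// divr_ge0//; lra.
  rewrite ler_pM2l//; apply: (le_trans l1); rewrite ler_wpM2l ?subr_ge0//.
  by rewrite lef_pV2.
Qed.

End Calculus.

(** * Closure properties of exponential decay *)

Section ExponentialDecay.
Variable R : realType.
Implicit Types (f g : R -> R) (a t T : R).

Lemma exp_decay_ge0 f : exp_decay f -> exists C c, [/\ 0 <= C, 0 < c &
  forall t, 0 <= t -> f t <= C * expR (- (c * t))].
Proof.
move=> [C [c [c0 h]]]; exists `|C|, c; split => // t t0.
by apply: (le_trans (h t t0)); rewrite ler_wpM2r ?expR_ge0 ?ler_norm.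
Qed.

Lemma exp_decay_le f g : (forall t, 0 <= t -> f t <= g t) ->
  exp_decay g -> exp_decay f.
Proof.
move=> fg [C [c [c0 h]]]; exists C, c; split => // t t0.
exact: le_trans (fg t t0) (h t t0).
Qed.

Lemma exp_decayD f g : exp_decay f -> exp_decay g ->
  exp_decay (fun t => f t + g t).
Proof.
move=> /exp_decay_ge0[C [c [C0 c0 hf]]] /exp_decay_ge0[D [d [D0 d0 hg]]].
exists (C + D), (Num.min c d); split; first by rewrite lt_min c0.
move=> t t0; rewrite mulrDl lerD//.
- apply: (le_trans (hf t t0)); rewrite ler_wpM2l// ler_expR lerN2 ler_wpM2r//.
  by rewrite ge_min lexx.
- apply: (le_trans (hg t t0)); rewrite ler_wpM2l// ler_expR lerN2 ler_wpM2r//.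
  by rewrite ge_min lexx orbT.
Qed.

Lemma exp_decayZ a f : 0 <= a -> exp_decay f -> exp_decay (fun t => a * f t).
Proof.
move=> a0 [C [c [c0 h]]]; exists (a * C), c; split => // t t0.
by rewrite -mulrA ler_wpM2l// h.
Qed.

Lemma exp_decay_sum (N : nat) (f : 'I_N -> R -> R) :
  (forall i, exp_decay (f i)) -> exp_decay (fun t => \sum_(i < N) f i t).
Proof.
elim: N f => [|N IH] f h.
  exists 0, 1; split => // t _; rewrite big_ord0 mul0r//.
apply: (@exp_decay_le _ (fun t => f ord0 t + \sum_(i < N) f (lift ord0 i) t)).
  by move=> t _; rewrite big_ord_recl.
by apply: exp_decayD; [exact: h|apply: IH].
Qed.

Lemma exp_decay_sqrt f : exp_decay f -> exp_decay (fun t => Num.sqrt (f t)).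
Proof.
move=> /exp_decay_ge0[C [c [C0 c0 h]]].
exists (Num.sqrt C), (c / 2); split => [|t t0]; first by rewrite divr_gt0.
apply: (le_trans (ler_wsqrtr (h t t0))); rewrite sqrtrM// ler_wpM2l ?sqrtr_ge0//.
have -> : - (c * t) = - (c / 2 * t) + - (c / 2 * t) by field.
by rewrite expRD -expr2 sqrtr_sqr ger0_norm ?expR_ge0.
Qed.

Lemma exp_decay_from f (T B : R) : 0 <= T ->
  (forall t, 0 <= t -> f t <= B) ->
  (exists C c, [/\ 0 <= C, 0 < c &
    forall t, T <= t -> f t <= C * expR (- (c * t))]) -> exp_decay f.
Proof.
move=> T0 fB [C [c [C0 c0 h]]].
(* On [[0, T]] the factor [expR (c * T)] compensates the decay, so the second term alone is at least
   [|B|]. *)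
exists (C + `|B| * expR (c * T)), c; split => // t t0.
case: (lerP T t) => [Tt|/ltW tT].
  by rewrite (le_trans (h t Tt))// ler_wpM2r ?expR_ge0// lerDl mulr_ge0 ?expR_ge0.
apply: (le_trans (fB t t0)); apply: (@le_trans _ _ `|B|); first exact: ler_norm.
rewrite mulrDl -mulrA -expRD.
have : 1 <= expR (c * T + - (c * t)).
  by rewrite -expR0 ler_expR; nra.
have := mulr_ge0 C0 (expR_ge0 (- (c * t))); have := normr_ge0 B; nra.
Qed.

Lemma exp_decay_lt f a : exp_decay f -> 0 < a ->
  exists2 T, 0 <= T & forall t, T <= t -> f t < a.
Proof.
move=> /exp_decay_ge0[C [c [C0 c0 h]]] a0.
(* From this time on, [expR (c * t) >= 1 + c * t > C / a]. *)
exists (C / (a * c)) => [|t Tt]; first by rewrite divr_ge0// ltW// mulr_gt0.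
have t0 : 0 <= t by rewrite (le_trans _ Tt)// divr_ge0// ltW// mulr_gt0.
apply: (le_lt_trans (h t t0)).
rewrite expRN ltr_pdivrMr ?expR_gt0//.
move: Tt; rewrite ler_pdivrMr ?mulr_gt0// => Tt.
have := expR_ge1Dx (c * t); nra.
Qed.

End ExponentialDecay.

(** * Pair sums and contraction by a symmetric consensus operator *)

Section WeightedSums.
Variables (R : realType) (N : nat) (m : 'I_N -> R).
Implicit Types (y z : 'I_N -> R).

(** The bilinear Lagrange identity. With [z] a consensus drift the last product vanishes, so a sum
    over pairs becomes a sum over single particles. *)
Lemma weighted_variance y z :
  \sum_i \sum_j m i * m j * ((y i - y j) * (z i - z j)) =
  2 * ((\sum_i m i) * (\sum_i m i * y i * z i)
       - (\sum_i m i * y i) * (\sum_i m i * z i)).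
Proof.
transitivity (\sum_i \sum_j (m i * (m j * y j * z j) + m i * y i * z i * m j
   - (m i * y i) * (m j * z j) - (m i * z i) * (m j * y j))).
  by apply: eq_bigr => i _; apply: eq_bigr => j _; ring.
under eq_bigr do rewrite !sumrB big_split /=.
by rewrite !sumrB big_split /= -!big_distrlr /=; ring.
Qed.

Section Consensus.
Variable psi : 'I_N -> 'I_N -> R.
Hypothesis psiC : forall i j, psi i j = psi j i.

(** The double sum is antisymmetric under exchange of [i] and [j]. *)
Lemma consensus_sum_eq0 y :
  \sum_i m i * (\sum_j m j * psi i j * (y j - y i)) = 0.
Proof.
set S := LHS; suff : S = - S by move=> h; lra.
rewrite /S -[RHS]sumrN; under eq_bigr do rewrite mulr_sumr.
rewrite exchange_big /=; apply: eq_bigr => i _.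
rewrite mulr_sumr -sumrN; apply: eq_bigr => j _; rewrite (psiC j i); ring.
Qed.

(** Summation by parts for a weighted graph Laplacian: add the sum to its copy with [i] and [j]
    exchanged. *)
Lemma consensus_dissipation y :
  2 * (\sum_i m i * y i * (\sum_j m j * psi i j * (y j - y i))) =
  - \sum_i \sum_j m i * m j * (psi i j * (y i - y j) ^+ 2).
Proof.
set S := (X in 2 * X).
have S1 : S = \sum_i \sum_j m i * m j * psi i j * (y i * (y j - y i)).
  by apply: eq_bigr => i _; rewrite mulr_sumr; apply: eq_bigr => j _; ring.
have S2 : S = \sum_i \sum_j m i * m j * psi i j * (y j * (y i - y j)).
  rewrite S1 exchange_big; apply: eq_bigr => i _; apply: eq_bigr => j _.
  by rewrite (psiC j i); ring.
rewrite mulr2n mulrDl mul1r {1}S1 S2 -big_split -sumrN; apply: eq_bigr => i _.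
by rewrite /= -big_split -sumrN; apply: eq_bigr => j _ /=; ring.
Qed.

Hypothesis m_ge0 : forall i, 0 <= m i.

(** The drift has zero weighted mean, so its share is the total mass times the dissipation, and
    [psi] is bounded below by [psi0]. The free term [g] lets one estimate serve both the [theta i]
    ([g = 0]) and the velocities (growth and friction). *)
Lemma consensus_contraction (psi0 : R) y g :
  (forall i j, psi0 <= psi i j) ->
  \sum_i \sum_j m i * m j * ((y i - y j) *
     ((\sum_k m k * psi i k * (y k - y i) + g i)
      - (\sum_k m k * psi j k * (y k - y j) + g j)))
  <= - ((\sum_i m i) * psi0) * (\sum_i \sum_j m i * m j * (y i - y j) ^+ 2)
     + \sum_i \sum_j m i * m j * ((y i - y j) * (g i - g j)).
Proof.
move=> psi0_le; pose A i := \sum_k m k * psi i k * (y k - y i).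
have -> : \sum_i \sum_j m i * m j * ((y i - y j) * ((A i + g i) - (A j + g j)))
  = \sum_i \sum_j m i * m j * ((y i - y j) * (A i - A j))
    + \sum_i \sum_j m i * m j * ((y i - y j) * (g i - g j)).
  rewrite -big_split; apply: eq_bigr => i _.
  by rewrite /= -big_split; apply: eq_bigr => j _ /=; ring.
rewrite lerD2r weighted_variance consensus_sum_eq0 mulr0 subr0 mulrCA.
rewrite consensus_dissipation mulrN mulNr lerN2 -mulrA.
rewrite ler_wpM2l ?sumr_ge0// mulr_sumr; apply: ler_sum => i _.
rewrite mulr_sumr; apply: ler_sum => j _.
rewrite mulrCA ler_wpM2l ?mulr_ge0//.
by rewrite ler_wpM2r ?sqr_ge0.
Qed.

End Consensus.
End WeightedSums.

(** Symmetrising, the sum is [(a - b) (|u|^2 - |w|^2) / 2 + (a + b) / 2 * |u - w|^2]. With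
    [a = |u|^p] and [b = |w|^p] this is the monotonicity of the friction. *)
Lemma radial_monotone (R : realType) (n : nat) (u w : 'I_n -> R) (a b : R) :
  0 <= a -> 0 <= b ->
  0 <= (a - b) * (\sum_k u k ^+ 2 - \sum_k w k ^+ 2) ->
  0 <= \sum_k (u k - w k) * (a * u k - b * w k).
Proof.
move=> a0 b0 h.
have -> : \sum_k (u k - w k) * (a * u k - b * w k) =
  (a - b) * (\sum_k u k ^+ 2 - \sum_k w k ^+ 2) / 2
  + \sum_k (a + b) / 2 * (u k - w k) ^+ 2.
  rewrite -sumrB mulr_sumr mulr_suml -big_split; apply: eq_bigr => k _ /=.
  by field.
apply: addr_ge0; first by rewrite divr_ge0.
by apply: sumr_ge0 => k _; rewrite mulr_ge0 ?sqr_ge0 ?divr_ge0 ?addr_ge0.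
Qed.

(** * The Euclidean norm compared with the coordinates *)

Section Enorm.
Variables (R : realType) (n : nat).
Implicit Types u w : 'rV[R]_n.

Lemma enorm_ge0 u : 0 <= enorm u.
Proof. exact: sqrtr_ge0. Qed.

Lemma enorm_sqr u : enorm u ^+ 2 = \sum_k u ord0 k ^+ 2.
Proof. by rewrite sqr_sqrtr// sumr_ge0// => k _; rewrite sqr_ge0. Qed.

Lemma enormN u : enorm (- u) = enorm u.
Proof.
by congr Num.sqrt; apply: eq_bigr => k _; rewrite mxE sqrrN.
Qed.

Lemma coord_le_enorm u k : `|u ord0 k| <= enorm u.
Proof.
rewrite -sqrtr_sqr ler_wsqrtr// (bigD1 k)//= lerDl sumr_ge0// => j _.
exact: sqr_ge0.
Qed.

Lemma enorm_le_sum u : enorm u <= \sum_k `|u ord0 k|.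
Proof.
have s0 : 0 <= \sum_k `|u ord0 k| by apply: sumr_ge0.
rewrite -(ger0_norm s0) -sqrtr_sqr ler_wsqrtr// expr2 mulr_suml.
apply: ler_sum => k _; rewrite -real_normK ?num_real// expr2 ler_wpM2l//.
by rewrite (bigD1 k)//= lerDl sumr_ge0.
Qed.

Lemma exp_decay_enorm (u : R -> 'rV[R]_n) :
  (forall k, exp_decay (fun t => `|u t ord0 k|)) ->
  exp_decay (fun t => enorm (u t)).
Proof.
move=> h; apply: exp_decay_le (exp_decay_sum h) => t _; exact: enorm_le_sum.
Qed.

End Enorm.

(** * The system in coordinates *)

Section Dynamics.
Variables (R : realType) (N n : nat) (m : 'I_N -> R) (sigma p kappa : R).
Variables (phi : R -> R) (x v : 'I_N -> R -> 'rV[R]_n) (theta : 'I_N -> R -> R).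
Variable phi_min : R.
Hypothesis N_gt0 : (1 <= N)%N.
Hypothesis m_gt0 : forall i, 0 < m i.
Hypothesis sigma_gt0 : 0 < sigma.
Hypothesis p_gt0 : 0 < p.
Hypothesis kappa_gt0 : 0 < kappa.
Hypothesis theta0_gt0 : forall i, 0 < theta i 0.
Hypothesis phi_min_gt0 : 0 < phi_min.
Hypothesis phi_ge : forall r, 0 <= r -> phi_min <= phi r.
Hypothesis phi_le : forall r, 0 <= r -> phi r <= phi 0.
Hypothesis sol : CSF_solution m sigma p kappa phi x v theta.

Let M := total_mass m.
Let thb := theta_bar m theta.
Let phx i j (t : R) : R := phi (enorm (x i t - x j t)).
Let y i k (t : R) : R := v i t ord0 k.
(** The squared speed is polynomial in the coordinates, hence differentiable also where the velocity
    vanishes; [|v|^p] becomes [r^(p/2)]. *)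
Let r i (t : R) : R := \sum_k y i k t ^+ 2.

Let m_ge0 i : 0 <= m i. Proof. exact: ltW. Qed.

Lemma total_mass_gt0 : 0 < M.
Proof.
rewrite /M /total_mass (bigD1 (Ordinal N_gt0))//= ltr_pwDl//.
exact: sumr_ge0.
Qed.

Lemma theta_bar_gt0 : 0 < thb.
Proof.
rewrite divr_gt0 ?total_mass_gt0// (bigD1 (Ordinal N_gt0))//=.
rewrite ltr_pwDl ?mulr_gt0// sumr_ge0// => i _.
by rewrite mulr_ge0// ltW.
Qed.

Let phxC i j t : phx i j t = phx j i t.
Proof. by rewrite /phx -enormN opprB. Qed.

Let phx_ge i j t : phi_min <= phx i j t.
Proof. exact/phi_ge/enorm_ge0. Qed.

Let phx_le i j t : phx i j t <= phi 0.
Proof. exact/phi_le/enorm_ge0. Qed.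

Lemma enorm_powR i t : enorm (v i t) `^ p = r i t `^ (p / 2).
Proof.
rewrite /enorm -powR12_sqrt ?sumr_ge0// => [|k _]; last exact: sqr_ge0.
by rewrite -powRrM mulrC.
Qed.

Lemma is_derive_velocity i k (t : R) : 0 <= t -> is_derive t 1 (y i k)
  (\sum_j m j * phx i j t * (y j k t - y i k t)
   + sigma * (theta i t - r i t `^ (p / 2)) * y i k t).
Proof.
move=> t0; have [_ h _] := sol t0 i.
apply: (is_derive_eq (is_derive_coord k h)).
rewrite !mxE summxE enorm_powR; congr (_ + _).
by apply: eq_bigr => j _; rewrite !mxE.
Qed.

(** The factor [kappa] inside the kernel and the summand [0] give the equation the shape that
    [consensus_contraction] expects. *)
Lemma is_derive_theta i (t : R) : 0 <= t -> is_derive t 1 (theta i)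
  (\sum_j m j * (kappa * phx i j t) * (theta j t - theta i t) + 0).
Proof.
move=> t0; have [_ _ h] := sol t0 i.
apply: (is_derive_eq h); rewrite addr0 mulr_sumr.
by apply: eq_bigr => j _; rewrite /phx; ring.
Qed.

(** * Pair energies and convergence of the [theta i] *)

Lemma theta_mean (t : R) : 0 <= t -> \sum_i m i * theta i t = M * thb.
Proof.
move=> t0; rewrite mulrCA mulfV ?gt_eqF ?total_mass_gt0// mulr1.
have hd (s : R) : 0 <= s -> is_derive s 1 (fun s => \sum_i m i * theta i s) 0.
  move=> s0; have h i := is_derive_scal (m i) (is_derive_theta i s0).
  apply: (is_derive_eq (is_derive_bigsum h)).
  under eq_bigr do rewrite addr0.
  apply: (@consensus_sum_eq0 R N m (fun i j => kappa * phx i j s)) => i j.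
  by rewrite phxC.
apply/eqP; rewrite eq_le; apply/andP; split.
  exact: (nonincreasing_from hd _ (lexx 0) t0).
(* The negated mean is nonincreasing as well, which gives the reverse inequality. *)
have hN (s : R) : 0 <= s -> is_derive s 1 (fun s => -1 * \sum_i m i * theta i s) 0.
  by move=> s0; apply: (is_derive_eq (is_derive_scal _ (hd s s0))); rewrite mulr0.
have := nonincreasing_from hN _ (lexx 0) t0; rewrite !mulN1r lerN2.
by apply.
Qed.

Lemma pair_energy_is_derive (z : 'I_N -> R -> R) (dz : 'I_N -> R) (t : R) :
  (forall i, is_derive t 1 (z i) (dz i)) ->
  is_derive t 1 (fun s => \sum_i \sum_j m i * m j * (z i s - z j s) ^+ 2)
    (2 * \sum_i \sum_j m i * m j * ((z i t - z j t) * (dz i - dz j))).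
Proof.
move=> h.
have hij i j := is_derive_scal (m i * m j) (is_derive_sqr (is_derive_sub (h i) (h j))).
have hi i := is_derive_bigsum (hij i).
apply: (is_derive_eq (is_derive_bigsum hi)); rewrite mulr_sumr.
apply: eq_bigr => i _; rewrite mulr_sumr; apply: eq_bigr => j _; ring.
Qed.

Lemma pair_le_energy (z : 'I_N -> R) i j :
  m i * m j * (z i - z j) ^+ 2 <=
  \sum_i \sum_j m i * m j * (z i - z j) ^+ 2.
Proof.
have pos i' j' : 0 <= m i' * m j' * (z i' - z j') ^+ 2.
  by rewrite mulr_ge0 ?sqr_ge0 ?mulr_ge0 ?m_ge0.
rewrite (bigD1 i)//= (bigD1 j)//= -addrA lerDl addr_ge0//.
  by apply: sumr_ge0 => j' _; apply: pos.
by apply: sumr_ge0 => i' _; apply: sumr_ge0 => j' _; apply: pos.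
Qed.

Lemma pair_exp_decay (z : 'I_N -> R -> R) i j :
  exp_decay (fun t => \sum_i \sum_j m i * m j * (z i t - z j t) ^+ 2) ->
  exp_decay (fun t => `|z i t - z j t|).
Proof.
move=> h; have mm : 0 < m i * m j by rewrite mulr_gt0.
have /exp_decayZ/(_ h) h' : 0 <= (m i * m j)^-1 by rewrite invr_ge0 ltW.
apply: exp_decay_le (exp_decay_sqrt h') => t _ /=.
rewrite -sqrtr_sqr ler_wsqrtr// ler_pdivlMl//; exact: pair_le_energy.
Qed.

Lemma theta_pair_decay i j : exp_decay (fun t => `|theta i t - theta j t|).
Proof.
apply: pair_exp_decay; set E := fun t => _.
pose a := 2 * (M * (kappa * phi_min)).
have a0 : 0 < a by rewrite !mulr_gt0 ?total_mass_gt0.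
have hd (t : R) (t0 : 0 <= t) : is_derive t 1 E _ :=
  pair_energy_is_derive (fun i => is_derive_theta i t0).
(* There is no forcing: [C := 0], and [c := 1] is an arbitrary positive rate. *)
have [|||C [c [C0 c0 h]]] := gronwall_from (C := 0) (c := 1) (lexx 0) a0 _ _ hd => //.
  move=> t t0; rewrite mul0r addr0.
  rewrite (_ : - a * _ = 2 * (- (M * (kappa * phi_min)) * E t)); last by rewrite /a; ring.
  rewrite ler_wpM2l//.
  have := @consensus_contraction R N m (fun i j => kappa * phx i j t).
  move=> /(_ _ m_ge0 (kappa * phi_min) (theta^~ t) (fun=> 0)) H.
  apply: (le_trans (H _ _)).
  - by move=> i' j'; rewrite phxC.
  - by move=> i' j'; rewrite ler_wpM2l// ltW.
  - rewrite [X in _ + X]big1 ?addr0// => i' _.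
    by rewrite big1// => j' _; rewrite subrr !mulr0.
by exists C, c.
Qed.

(** By conservation of the mean, [theta i - thb] is the weighted average of the differences
    [theta i - theta j]. *)
Lemma theta_decay i : exp_decay (fun t => `|theta i t - thb|).
Proof.
have h := exp_decay_sum (fun j => exp_decayZ (m_ge0 j) (theta_pair_decay i j)).
have /exp_decayZ/(_ h) h' : 0 <= M^-1 by rewrite invr_ge0 ltW ?total_mass_gt0.
apply: exp_decay_le h' => t t0 /=.
rewrite ler_pdivlMl ?total_mass_gt0// -{1}(ger0_norm (ltW total_mass_gt0)).
rewrite -normrM mulrBr -(theta_mean t0) /M /total_mass mulr_suml -sumrB.
apply: (le_trans (ler_norm_sum _ _ _)); apply: ler_sum => j _.
by rewrite -mulrBr normrM ger0_norm.
Qed.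

(** * Uniform bounds on the velocities *)

Lemma theta_bounded i : exists B, forall t, 0 <= t -> theta i t <= B.
Proof.
have /exp_decay_ge0[C [c [C0 c0 h]]] := theta_decay i.
exists (thb + C) => t t0; have := h t t0; rewrite ler_norml => /andP[_ h1].
have : expR (- (c * t)) <= 1 by rewrite -expR0 ler_expR; nra.
nra.
Qed.

(** The energy [\sum_i m i * r i] is dissipated by consensus, and friction beats growth at high
    speed. Taking [B >= 1] turns [|y|^2 <= B] into [|y| <= B], so one constant bounds both. *)
Lemma velocity_bounded : exists2 B, 1 <= B &
  forall i t, 0 <= t -> r i t <= B /\ forall k, `|y i k t| <= B.
Proof.
have [b hb] := choice theta_bounded.
(* [Th] exceeds every [theta i] by at least 1. If [s^(p/2) >= Th], growth minus friction is at most
   [- s]; otherwise [s <= s0] and [A] absorbs the growth. Both cases give [damp]. *)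
pose Th := 1 + \sum_i `|b i|.
have Th1 : 1 <= Th by rewrite lerDl sumr_ge0.
have hTh i (t : R) : 0 <= t -> theta i t <= Th - 1.
  move=> t0; rewrite /Th addrAC subrr add0r (le_trans (hb i t t0))//.
  by rewrite (le_trans (ler_norm _))// (bigD1 i)//= lerDl sumr_ge0.
have q0 : 0 < p / 2 by rewrite divr_gt0.
pose s0 := Th `^ (p / 2)^-1; pose A := Th * s0.
have s00 : 0 <= s0 by exact: powR_ge0.
have A0 : 0 <= A by rewrite mulr_ge0// (le_trans ler01).
have damp th s : th <= Th - 1 -> 0 <= s -> (th - s `^ (p / 2)) * s <= A - s.
  move=> thTh s_ge0; case: (lerP Th (s `^ (p / 2))) => sTh.
    have : (th - s `^ (p / 2) + 1) * s <= 0 by rewrite mulr_le0_ge0//; lra.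
    lra.
  have ss0 : s <= s0.
    have -> : s = (s `^ (p / 2)) `^ (p / 2)^-1.
      by rewrite -powRrM mulfV ?gt_eqF// powRr1.
    by rewrite ge0_ler_powR ?nnegrE ?powR_ge0// ?invr_ge0; lra.
  by have := powR_ge0 s (p / 2); rewrite /A; nra.
have r_ge0 i t : 0 <= r i t by apply: sumr_ge0 => k _; exact: sqr_ge0.
(* Subtracting the equilibrium value [A * M] makes the inequality homogeneous:
   [K' <= - 2 sigma K]. *)
pose K (t : R) := (\sum_i m i * r i t) - A * M.
have hd (t : R) (t0 : 0 <= t) : is_derive t 1 K _ :=
  is_derive_sub (is_derive_bigsum (fun i => is_derive_scal (m i)
    (is_derive_bigsum (fun k => is_derive_sqr (is_derive_velocity i k t0)))))
   (is_derive_cst (A * M) t 1).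
have a0 : 0 < 2 * sigma by rewrite mulr_gt0.
have [|||C [c [C0 c0 h]]] := gronwall_from (C := 0) (c := 1) (lexx 0) a0 _ _ hd => //.
  move=> t t0; rewrite mul0r addr0 subr0.
  set a := fun i k => \sum_j m j * phx i j t * (y j k t - y i k t).
  have -> : \sum_i m i * \sum_k 2 * y i k t *
      (a i k + sigma * (theta i t - r i t `^ (p / 2)) * y i k t) =
    \sum_k 2 * (\sum_i m i * y i k t * a i k) +
    2 * sigma * \sum_i m i * ((theta i t - r i t `^ (p / 2)) * r i t).
    under [X in _ = X + _]eq_bigr do rewrite mulr_sumr.
    rewrite exchange_big mulr_sumr -big_split; apply: eq_bigr => i _ /=.
    rewrite mulrA mulrA /r !mulr_sumr -big_split; apply: eq_bigr => k _ /=.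
    by rewrite -/(r i t); ring.
  rewrite mulNr -mulrN opprB -[leRHS]add0r lerD//.
    apply: sumr_le0 => k _.
    rewrite (consensus_dissipation m (psi := fun i j => phx i j t))//.
    rewrite oppr_le0; apply: sumr_ge0 => i _; apply: sumr_ge0 => j _.
    apply: mulr_ge0; first by rewrite mulr_ge0 ?m_ge0.
    by rewrite mulr_ge0 ?sqr_ge0// (le_trans (ltW phi_min_gt0)) ?phx_ge.
  rewrite ler_wpM2l ?(ltW a0)// /M /total_mass mulr_sumr -sumrB.
  apply: ler_sum => i _; rewrite [A * _]mulrC -mulrBr ler_wpM2l ?m_ge0//.
  by apply: damp; [exact: hTh|exact: r_ge0].
pose B := 1 + \sum_i (C + A * M) / m i.
have CA : 0 <= C + A * M by rewrite addr_ge0// mulr_ge0// ltW// total_mass_gt0.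
have B1 : 1 <= B by rewrite lerDl sumr_ge0// => i _; rewrite divr_ge0 ?m_ge0.
exists B => // i t t0.
have rB : r i t <= B.
  apply: (@le_trans _ _ ((C + A * M) / m i)); last first.
    rewrite /B (bigD1 i)//= addrCA lerDl addr_ge0// sumr_ge0// => j _.
    by rewrite divr_ge0 ?m_ge0.
  rewrite ler_pdivlMr// mulrC -lerBlDr.
  apply: (@le_trans _ _ (K t)).
    rewrite lerD2r (bigD1 i)//= lerDl sumr_ge0// => j _.
    by rewrite mulr_ge0 ?m_ge0.
  apply: (le_trans (h t t0)).
  by rewrite -[leRHS]mulr1 ler_wpM2l// -expR0 ler_expR; nra.
split => // k.
have : `|y i k t| ^+ 2 <= B.
  apply: le_trans rB; rewrite real_normK ?num_real// /r (bigD1 k)//= lerDl.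
  by rewrite sumr_ge0// => j _; exact: sqr_ge0.
by have := normr_ge0 (y i k t); nra.
Qed.

(** * Alignment of the velocities *)

Hypothesis gap : sigma * thb < phi_min * M.

(** Write [theta i = thb + (theta i - thb)]. The mean gives the quadratic term, friction has a
    favourable sign by [radial_monotone], and the deviations are multiplied by factors bounded by
    [2 * B] and [B]. *)
Lemma velocity_pair_growth B i j t :
  (forall k, `|y i k t| <= B) -> (forall k, `|y j k t| <= B) ->
  \sum_k (y i k t - y j k t) *
    (sigma * (theta i t - r i t `^ (p / 2)) * y i k t
     - sigma * (theta j t - r j t `^ (p / 2)) * y j k t)
  <= sigma * thb * (\sum_k (y i k t - y j k t) ^+ 2)
   + \sum_(k < n) sigma * (2 * B ^+ 2) * (`|theta i t - thb| + `|theta j t - thb|).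
Proof.
move=> yi yj; set b1 := r i t `^ _; set b2 := r j t `^ _.
have r_ge0 l : 0 <= r l t by apply: sumr_ge0 => k _; exact: sqr_ge0.
have mono : 0 <= \sum_k (y i k t - y j k t) * (b1 * y i k t - b2 * y j k t).
  apply: radial_monotone; rewrite ?powR_ge0// -/(r i t) -/(r j t).
  have mon l l' : r l t <= r l' t -> r l t `^ (p / 2) <= r l' t `^ (p / 2).
    by move=> ll'; rewrite ge0_ler_powR ?nnegrE// divr_ge0// ltW.
  by case: (lerP (r i t) (r j t)) => [/[dup] /mon|/ltW/[dup]/mon];
    rewrite -/b1 -/b2; nra.
have -> : \sum_k (y i k t - y j k t) *
    (sigma * (theta i t - b1) * y i k t - sigma * (theta j t - b2) * y j k t)
  = sigma * thb * (\sum_k (y i k t - y j k t) ^+ 2)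
   + \sum_k sigma * ((y i k t - y j k t) *
       ((theta i t - thb) * y i k t - (theta j t - thb) * y j k t))
   - sigma * \sum_k (y i k t - y j k t) * (b1 * y i k t - b2 * y j k t).
  rewrite !mulr_sumr -big_split -sumrB; apply: eq_bigr => k _ /=; ring.
apply: (@le_trans _ _ (sigma * thb * (\sum_k (y i k t - y j k t) ^+ 2)
   + \sum_k sigma * ((y i k t - y j k t) *
       ((theta i t - thb) * y i k t - (theta j t - thb) * y j k t)))).
  by rewrite gerBl mulr_ge0// ltW.
rewrite lerD2l; apply: ler_sum => k _.
rewrite -mulrA ler_wpM2l ?(ltW sigma_gt0)// (le_trans (ler_norm _))// normrM.
have B0 : 0 <= B := le_trans (normr_ge0 _) (yi k).
rewrite (_ : 2 * B ^+ 2 * _ =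
  (2 * B) * ((`|theta i t - thb| + `|theta j t - thb|) * B)); last by ring.
apply: ler_pM => //.
  by rewrite (le_trans (ler_normB _ _))// mulr_natl mulr2n lerD.
by rewrite (le_trans (ler_normB _ _))// [leRHS]mulrDl !normrM lerD// ler_wpM2l.
Qed.

Lemma velocity_pair_decay i j k : exp_decay (fun t => `|y i k t - y j k t|).
Proof.
apply: (@pair_exp_decay (fun i => y i k)).
have [B B1 hB] := velocity_bounded.
pose S k (t : R) := \sum_i \sum_j m i * m j * (y i k t - y j k t) ^+ 2.
(* Friction couples the coordinates and is monotone as a statement about the full scalar product, so
   the energy is summed over [k]. *)
pose F (t : R) := \sum_k S k t.
have hd (t : R) (t0 : 0 <= t) : is_derive t 1 F _ :=
  is_derive_bigsum (fun k => pair_energy_is_derive (fun i => is_derive_velocity i k t0)).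
have S0 k' t : 0 <= S k' t.
  by apply: sumr_ge0 => i' _; apply: sumr_ge0 => j' _;
     rewrite mulr_ge0 ?sqr_ge0// mulr_ge0 ?m_ge0.
pose g t := \sum_i \sum_j m i * m j * (\sum_(k < n) sigma * (2 * B ^+ 2) *
   (`|theta i t - thb| + `|theta j t - thb|)).
have gdec : exp_decay (fun t => 2 * g t).
  apply: exp_decayZ => //; apply: exp_decay_sum => i'; apply: exp_decay_sum => j'.
  apply: exp_decayZ; first by rewrite mulr_ge0 ?m_ge0.
  apply: exp_decay_sum => k'; apply: exp_decayZ.
    by rewrite mulr_ge0 ?(ltW sigma_gt0)// mulr_ge0 ?sqr_ge0.
  by apply: exp_decayD; exact: theta_decay.
have [C [c [C0 c0 gC]]] := exp_decay_ge0 gdec.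
(* The contraction rate left after subtracting the growth rate; [gap] makes it positive. *)
have a0 : 0 < 2 * (M * phi_min - sigma * thb) by rewrite mulr_gt0// subr_gt0 [M * _]mulrC.
have [|C' [c' [C'0 c'0 h]]] := gronwall_from (lexx 0) a0 c0 C0 hd; last first.
  exists C', c'; split => // t t0; apply: le_trans (h t t0).
  by rewrite /F (bigD1 k)//= lerDl sumr_ge0.
move=> t t0; apply: le_trans (lerD (lexx _) (gC t t0)).
rewrite mulNr -mulrN -mulrA -mulrDr -mulr_sumr ler_wpM2l//.
pose G i k := sigma * (theta i t - r i t `^ (p / 2)) * y i k t.
apply: (@le_trans _ _ (\sum_k (- (M * phi_min) * S k t + \sum_i \sum_j m i * m j *
   ((y i k t - y j k t) * (G i k - G j k))))).
  apply: ler_sum => k' _.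
  apply: (consensus_contraction (psi := fun i j => phx i j t)) => *.
  - exact: phxC.
  - exact: m_ge0.
  - exact: phx_ge.
rewrite big_split /= -mulr_sumr -/(F t).
have -> : (M * phi_min - sigma * thb) * - F t + g t =
  - (M * phi_min) * F t + (sigma * thb * F t + g t) by ring.
rewrite lerD2l.
(* With the sum over [k] moved innermost, the estimate reduces to a single pair of particles. *)
rewrite exchange_big [F t]exchange_big mulr_sumr /g -big_split; apply: ler_sum => i' _ /=.
rewrite exchange_big [X in _ * X]exchange_big mulr_sumr -big_split.
apply: ler_sum => j' _ /=.
rewrite -[leLHS]mulr_sumr -[X in _ * X + _]mulr_sumr mulrCA -mulrDr ler_wpM2l ?mulr_ge0 ?m_ge0//.
by apply: velocity_pair_growth => k'; [exact: (hB i' t t0).2|exact: (hB j' t t0).2].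
Qed.

Lemma vel_diam_decay : exp_decay (vel_diam v).
Proof.
have h i j : exp_decay (fun t => enorm (v i t - v j t)).
  apply: exp_decay_enorm => k.
  by under eq_fun do rewrite !mxE; exact: velocity_pair_decay.
(* The norms are nonnegative, so each maximum with default 0 is at most the corresponding sum. *)
apply: exp_decay_le (exp_decay_sum (fun i => exp_decay_sum (h i))) => t _ /=.
have s0 i : 0 <= \sum_j enorm (v i t - v j t).
  by apply: sumr_ge0 => j _; exact: enorm_ge0.
apply: bigmax_le => [|i _]; first exact: sumr_ge0.
apply: (@le_trans _ _ (\sum_j enorm (v i t - v j t))); last first.
  by rewrite [leRHS](bigD1 i)//= lerDl sumr_ge0.
apply: bigmax_le => [|j _]; first exact: s0.
by rewrite [leRHS](bigD1 j)//= lerDl sumr_ge0// => l _; exact: enorm_ge0.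
Qed.

(** * The speed of a reference particle *)

Let i0 : 'I_N := Ordinal N_gt0.
Let vinf := thb `^ p^-1.

Let r_ge0 i t : 0 <= r i t.
Proof. by apply: sumr_ge0 => k _; exact: sqr_ge0. Qed.

Let vinf_gt0 : 0 < vinf.
Proof. exact/powR_gt0/theta_bar_gt0. Qed.

(** Thus [vinf ^+ 2] is the positive equilibrium of [r' = 2 sigma (thb - r^(p/2)) r]. *)
Let vinf_powR : (vinf ^+ 2) `^ (p / 2) = thb.
Proof.
rewrite -powR_mulrn ?powR_ge0// -!powRrM (_ : _ * _ = 1) ?powRr1//.
  exact/ltW/theta_bar_gt0.
by field; rewrite gt_eqF.
Qed.

(** [E] collects the consensus term, small by alignment since the kernel is at most [phi 0], and the
    deviation of [theta i0] from [thb]; the remaining factors are bounded. *)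
Lemma reference_speed_ode : exists2 E, exp_decay (fun t => `|E t|) &
  forall t : R, 0 <= t -> is_derive t 1 (r i0)
    (2 * sigma * (thb - r i0 t `^ (p / 2)) * r i0 t + E t).
Proof.
have [B B1 hB] := velocity_bounded.
pose G (t : R) := \sum_k 2 * y i0 k t *
  (\sum_j m j * phx i0 j t * (y j k t - y i0 k t)).
exists (fun t => G t + 2 * sigma * (theta i0 t - thb) * r i0 t).
  have Gdec : exp_decay (fun t => \sum_(k < n) 2 * B *
      \sum_j m j * phi 0 * `|y j k t - y i0 k t|).
    apply: exp_decay_sum => k; apply: exp_decayZ; first by rewrite mulr_ge0//; lra.
    apply: exp_decay_sum => j; apply: exp_decayZ; last exact: velocity_pair_decay.
    by rewrite mulr_ge0 ?m_ge0// (le_trans _ (phi_ge _))// ltW.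
  have sB0 : 0 <= 2 * sigma * B by rewrite mulr_ge0 ?mulr_ge0 ?(ltW sigma_gt0)//; lra.
  apply: exp_decay_le (exp_decayD Gdec (exp_decayZ sB0 (theta_decay i0))) => t t0 /=.
  rewrite (le_trans (ler_normD _ _))// lerD//.
    rewrite (le_trans (ler_norm_sum _ _ _))//; apply: ler_sum => k _.
    rewrite 2!normrM (ger0_norm (ler0n _ _)); apply: ler_pM => //.
      by rewrite ler_wpM2l// (hB i0 t t0).2.
    rewrite (le_trans (ler_norm_sum _ _ _))//; apply: ler_sum => j _.
    rewrite normrM ler_wpM2r// ger0_norm ?ler_wpM2l ?m_ge0//.
    by rewrite mulr_ge0 ?m_ge0// (le_trans (ltW phi_min_gt0)) ?phx_ge.
  rewrite 2!normrM (ger0_norm (r_ge0 _ _)) [`|2 * sigma|]ger0_norm; last first.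
    by rewrite mulr_ge0// ltW.
  rewrite -!mulrA [B * _]mulrC !ler_wpM2l ?(ltW sigma_gt0)//.
  exact: (hB i0 t t0).1.
move=> t t0.
apply: (is_derive_eq (is_derive_bigsum
  (fun k => is_derive_sqr (is_derive_velocity i0 k t0)))).
rewrite addrCA /G [2 * sigma * (thb - _) * _]mulr_sumr.
rewrite [2 * sigma * _ * _]mulr_sumr -!big_split; apply: eq_bigr => k _ /=.
by ring.
Qed.

Lemma reference_speed_decay (e : R) : 0 < e ->
  (forall T : R, 0 <= T -> exists2 t, T <= t & e <= r i0 t) ->
  exp_decay (fun t => `|r i0 t - vinf ^+ 2|).
Proof.
move=> e0 io; have [E Edec hd] := reference_speed_ode.
have [B B1 hB] := velocity_bounded.
have q0 : 0 < p / 2 by rewrite divr_gt0.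
have w0 : 0 < vinf ^+ 2 by rewrite exprn_gt0.
set w := vinf ^+ 2 in w0 *.
have wq : w `^ (p / 2) = thb := vinf_powR.
(* At most [e], so that the level is reached; at most [w / 2], so that the drift on it is strictly
   positive. *)
pose eps := Num.min e (w / 2).
have eps0 : 0 < eps by rewrite lt_min e0; lra.
have epse : eps <= e by rewrite ge_min lexx.
have epsw : eps <= w / 2 by rewrite ge_min lexx orbT.
have epsq : 0 < thb - eps `^ (p / 2).
  by rewrite subr_gt0 -wq gt0_ltr_powR ?nnegrE//; lra.
have eta0 : 0 < 2 * sigma * (thb - eps `^ (p / 2)) * eps.
  by rewrite !mulr_gt0.
(* After [T] the perturbation is smaller than the drift on the level [eps], hence [r' > 0] there. *)
have [T T0 hT] := exp_decay_lt Edec eta0.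
have [T1 TT1 eT1] := io T T0.
have T10 : 0 <= T1 by lra.
have trap : forall t, T1 <= t -> eps <= r i0 t.
  apply: (@positivity_trap _ _ _ eps T1 (fun t Tt => hd t (le_trans T10 Tt))).
    move=> t Tt ->; have := hT t (le_trans TT1 Tt).
    by rewrite ltr_norml => /andP[]; lra.
  lra.
pose b := Num.max B w.
have Bb : B <= b by rewrite le_max lexx.
have wb : w <= b by rewrite le_max lexx orbT.
(* The lower slope of [s^(p/2)] on [[eps, b]], an interval containing both [w] and the trapped
   [r i0 t]. *)
pose k := p / 2 * eps `^ (p / 2) / b.
have k0 : 0 < k by rewrite divr_gt0 ?mulr_gt0 ?powR_gt0//; lra.
have dissip t : T1 <= t ->
    k * (r i0 t - w) ^+ 2 <= (r i0 t - w) * (r i0 t `^ (p / 2) - thb).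
  move=> Tt; have tr := trap t Tt; rewrite -wq.
  have rB : r i0 t <= B by apply: (hB i0 t _).1; lra.
  case: (lerP (r i0 t) w) => [rw|/ltW wr].
    have [] := @powR_bilipschitz R (p / 2) eps b _ _ q0 eps0 tr rw wb.
    by rewrite -/k; nra.
  have [||] := @powR_bilipschitz R (p / 2) eps b w (r i0 t) q0 eps0 _ wr.
  - by lra.
  - by lra.
  - by rewrite -/k; nra.
(* Since [r >= eps], [dissip] yields [f' <= - 4 sigma k eps f + 2 b |E|], ready for Gronwall. *)
pose f (t : R) := (r i0 t - w) ^+ 2.
have a0 : 0 < 4 * sigma * k * eps by rewrite mulr_gt0// mulr_gt0// mulr_gt0.
have b0 : 0 <= 2 * b by lra.
have rwb t : 0 <= t -> `|r i0 t - w| <= b.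
  move=> t0; have := (hB i0 t t0).1; have := r_ge0 i0 t.
  by rewrite ler_norml; lra.
have [C [c [C0 c0 hC]]] := exp_decay_ge0 (exp_decayZ b0 Edec).
have hdf (t : R) (Tt : T1 <= t) : is_derive t 1 f _ :=
  is_derive_sqr (is_derive_sub (hd t (le_trans T10 Tt)) (is_derive_cst w t 1)).
have fdec : exp_decay f.
  apply: (@exp_decay_from _ _ T1 (b ^+ 2)) => //.
    move=> t t0; rewrite /f -real_normK ?num_real// lerXn2r ?nnegrE//.
      by lra.
    exact: rwb.
  apply: (gronwall_from T10 a0 c0 C0 hdf) => t Tt.
  have t0 : 0 <= t by lra.
  rewrite subr0; apply: le_trans (lerD (lexx _) (hC t t0)).
  rewrite [2 * (r i0 t - w) * _]mulrDr lerD//; last first.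
    rewrite (le_trans (ler_norm _))// !normrM (ger0_norm (ler0n _ _)).
    by rewrite ler_wpM2r// ler_wpM2l// rwb.
  rewrite (_ : 2 * _ * _ = - (4 * sigma * (r i0 t *
    ((r i0 t - w) * (r i0 t `^ (p / 2) - thb))))); last by ring.
  rewrite mulNr lerN2.
  rewrite (_ : _ * k * eps * _ = 4 * sigma * (eps * (k * f t))); last by ring.
  rewrite ler_wpM2l//; first by rewrite mulr_ge0// ltW.
  apply: ler_pM; rewrite ?trap//; first by rewrite ltW.
    by rewrite mulr_ge0 ?sqr_ge0// ltW.
  exact: dissip.
apply: exp_decay_le (exp_decay_sqrt fdec) => t _.
by rewrite /f sqrtr_sqr.
Qed.

(** * Convergence of the velocities and the dichotomy *)

Lemma velocity_limit : exp_decay (fun t => `|r i0 t - vinf ^+ 2|) ->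
  exists vb : 'rV[R]_n, enorm vb = vinf /\
    forall i, exp_decay (fun t => enorm (v i t - vb)).
Proof.
move=> rdec; have [B B1 hB] := velocity_bounded.
have q0 : 0 < p / 2 by rewrite divr_gt0.
have w0 : 0 < vinf ^+ 2 by rewrite exprn_gt0.
set w := vinf ^+ 2 in w0 rdec *.
have wq : w `^ (p / 2) = thb := vinf_powR.
have powdec : exp_decay (fun t => `|r i0 t `^ (p / 2) - thb|).
  have w20 : 0 < w / 2 by lra.
  (* For [p < 2] the power [s^(p/2)] is not Lipschitz at 0, so the comparison waits until
     [r >= w / 2]; earlier times are covered by a crude bound. *)
  have [T T0 hT] := exp_decay_lt rdec w20.
  apply: (@exp_decay_from _ _ T (B `^ (p / 2) + thb)) => // [t t0|].
    rewrite (le_trans (ler_normB _ _))// lerD//.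
      rewrite ger0_norm ?powR_ge0// ge0_ler_powR ?nnegrE//; first exact: ltW.
      - by lra.
      - exact: (hB i0 t t0).1.
    by rewrite ger0_norm// ltW// theta_bar_gt0.
  pose b := Num.max B w.
  have Bb : B <= b by rewrite le_max lexx.
  have wb : w <= b by rewrite le_max lexx orbT.
  pose L := p / 2 * b `^ (p / 2) / (w / 2).
  have L0 : 0 <= L by rewrite divr_ge0 ?mulr_ge0 ?powR_ge0//; lra.
  have [C [c [C0 c0 hC]]] := exp_decay_ge0 (exp_decayZ L0 rdec).
  exists C, c; split => // t Tt; have t0 : 0 <= t by lra.
  apply: le_trans (hC t t0).
  have := hT t Tt; rewrite ltr_norml => /andP[lo _].
  have rB := (hB i0 t t0).1; rewrite -wq.
  case: (lerP (r i0 t) w) => [rw|/ltW wr].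
    have [||h1 h2] := @powR_bilipschitz R (p / 2) (w / 2) b (r i0 t) w q0 w20 _ rw.
    - by lra.
    - by lra.
    by rewrite distrC ger0_norm// subr_ge0 ge0_ler_powR ?nnegrE//; lra.
  have [||h1 h2] := @powR_bilipschitz R (p / 2) (w / 2) b w (r i0 t) q0 w20 _ wr.
  - by lra.
  - by lra.
  by rewrite ger0_norm// subr_ge0 ge0_ler_powR ?nnegrE//; lra.
have lim k : exists l, exp_decay (fun t => `|y i0 k t - l|).
  (* A bound for the coordinate derivative of the reference velocity: consensus by alignment, and
     [theta i0 - r^(p/2)] split at [thb]. *)
  pose e t := (\sum_j m j * phi 0 * `|y j k t - y i0 k t|) +
    sigma * B * (`|theta i0 t - thb| + `|r i0 t `^ (p / 2) - thb|).
  have edec : exp_decay e.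
    apply: exp_decayD.
      apply: exp_decay_sum => j; apply: exp_decayZ; last exact: velocity_pair_decay.
      by rewrite mulr_ge0 ?m_ge0// (le_trans _ (phi_ge _))// ltW.
    apply: exp_decayZ; first by rewrite mulr_ge0 ?(ltW sigma_gt0)//; lra.
    by apply: exp_decayD; [exact: theta_decay|].
  have [C [c [C0 c0 hC]]] := exp_decay_ge0 edec.
  have [|l hl] := cvg_of_expR_derivative (C := C) c0 (is_derive_velocity i0 k); last first.
    by exists l; exists (C / c), c.
  move=> t t0; apply: le_trans (hC t t0).
  rewrite (le_trans (ler_normD _ _))// lerD//.
    rewrite (le_trans (ler_norm_sum _ _ _))//; apply: ler_sum => j _.
    rewrite normrM ler_wpM2r// ger0_norm ?ler_wpM2l ?m_ge0//.
    by rewrite mulr_ge0 ?m_ge0// (le_trans (ltW phi_min_gt0)) ?phx_ge.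
  rewrite 2!normrM (gtr0_norm sigma_gt0) -!mulrA ler_wpM2l ?(ltW sigma_gt0)//.
  rewrite [B * _]mulrC; apply: ler_pM => //; last exact: (hB i0 t t0).2.
  rewrite (_ : theta i0 t - _ = (theta i0 t - thb) - (r i0 t `^ (p / 2) - thb)).
    exact: ler_normB.
  by ring.
have [l hl] := choice lim.
pose vb : 'rV[R]_n := \row_k l k.
have conv i : exp_decay (fun t => enorm (v i t - vb)).
  apply: exp_decay_enorm => k.
  apply: exp_decay_le (exp_decayD (velocity_pair_decay i i0 k) (hl k)) => t _ /=.
  by rewrite !mxE -/(y i k t); exact: ler_distD.
exists vb; split => //.
have vb2 : enorm vb ^+ 2 = w.
  (* A constant function that decays exponentially must vanish. *)
  have h : exp_decay (fun t : R => `|w - enorm vb ^+ 2|).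
    have Bl k : 0 <= B + `|l k| by rewrite addr_ge0//; lra.
    apply: exp_decay_le (exp_decayD rdec
      (exp_decay_sum (fun k => exp_decayZ (Bl k) (hl k)))) => t t0 /=.
    apply: (le_trans (ler_distD (r i0 t) _ _)); rewrite distrC lerD2l.
    rewrite enorm_sqr -sumrB (le_trans (ler_norm_sum _ _ _))//.
    apply: ler_sum => k _; rewrite mxE subr_sqr normrM mulrC ler_wpM2r//.
    by rewrite (le_trans (ler_normD _ _))// lerD2r (hB i0 t t0).2.
  apply/eqP; rewrite eq_sym -subr_eq0 -normr_le0 leNgt; apply/negP => h0.
  by have [T _ /(_ T (lexx T))] := exp_decay_lt h h0; rewrite ltxx.
apply/eqP; rewrite -(eqrXn2 (n := 2))//; first by rewrite vb2.
- exact: enorm_ge0.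
- exact: ltW.
Qed.

Lemma velocities_vanish :
  (forall e, 0 < e -> exists T : R, forall t, T <= t -> r i0 t < e) ->
  forall i, enorm (v i t) @[t --> +oo] --> (0 : R).
Proof.
move=> small i; apply/cvgrPdist_lt => e e0.
have e20 : 0 < e / 2 by lra.
have ddec := exp_decay_sum (fun k => velocity_pair_decay i i0 k).
have [T1 T10 h1] := exp_decay_lt ddec e20.
(* The [n] coordinates then contribute at most [e / 2] in total; [n.+1] keeps the denominator
   nonzero. *)
pose a := e / 2 / n.+1%:R.
have a0 : 0 < a by rewrite divr_gt0.
have [T2 h2] := small _ (exprn_gt0 2 a0).
exists (Num.max T1 T2); split; first exact: num_real.
move=> t /=; rewrite gt_max => /andP[/ltW /h1 t1 /ltW /h2 t2].
rewrite sub0r normrN ger0_norm ?enorm_ge0//.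
apply: (@le_lt_trans _ _ (\sum_k `|y i k t - y i0 k t| + \sum_(k < n) a)).
  rewrite (le_trans (enorm_le_sum _))// -big_split; apply: ler_sum => k _ /=.
  rewrite -[v i t ord0 k](subrK (y i0 k t)) (le_trans (ler_normD _ _))// lerD2l.
  rewrite (le_trans (coord_le_enorm _ _))// -(ger0_norm (ltW a0)) -sqrtr_sqr.
  by rewrite ler_wsqrtr// ltW.
rewrite [ltRHS]splitr ltr_leD// sumr_const card_ord -[leLHS]mulr_natr /a.
rewrite -[leLHS]mulrA ler_piMr ?(ltW e20)// mulrC ler_pdivrMr// mul1r ler_nat.
exact: leqnSn.
Qed.

(** At a late time both [v i0 t] and [v i0 t - vb] have norm below [a]; summing coordinates gives
    [vinf <= 2 n a = vinf * n / (n + 1)], which is absurd. *)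
Lemma alternatives_exclusive :
  (forall i, enorm (v i t) @[t --> +oo] --> (0 : R)) ->
  ~ exists vb : 'rV[R]_n, enorm vb = vinf /\
      forall i, exp_decay (fun t => enorm (v i t - vb)).
Proof.
move=> h0 [vb [vbE /(_ i0) h1]].
pose a := vinf / 2 / n.+1%:R.
have a0 : 0 < a by rewrite !divr_gt0.
have [T1 T10 hT1] := exp_decay_lt h1 a0.
have /cvgrPdist_lt/(_ _ a0) [T2 [_ hT2]] := h0 i0.
pose t := Num.max T1 T2 + 1.
have t1 : T1 < t by rewrite ltr_pwDr// le_max lexx.
have t2 : T2 < t by rewrite ltr_pwDr// le_max lexx orbT.
have := hT2 t t2; rewrite /= sub0r normrN ger0_norm ?enorm_ge0// => va.
have vba := hT1 t (ltW t1).
have : vinf <= \sum_(k < n) (a + a).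
  rewrite -vbE (le_trans (enorm_le_sum _))//; apply: ler_sum => k _.
  rewrite (_ : vb ord0 k = v i0 t ord0 k - (v i0 t - vb) ord0 k); last first.
    by rewrite !mxE; ring.
  rewrite (le_trans (ler_normB _ _))// lerD//.
    exact: le_trans (coord_le_enorm _ _) (ltW va).
  exact: le_trans (coord_le_enorm _ _) (ltW vba).
apply/negP; rewrite -ltNge sumr_const card_ord -[ltLHS]mulr_natr.
rewrite (_ : (a + a) * _ = vinf * (n%:R / n.+1%:R)); last first.
  by rewrite /a -mulrDl -splitr mulrAC mulrA.
by rewrite gtr_pMr// ltr_pdivrMr// mul1r ltr_nat.
Qed.

Lemma velocity_dichotomy :
  let P1 := forall i, enorm (v i t) @[t --> +oo] --> (0 : R) in
  let P2 := exists vb : 'rV[R]_n, enorm vb = vinf /\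
    forall i, exp_decay (fun t => enorm (v i t - vb)) in
  (P1 /\ ~ P2) \/ (~ P1 /\ P2).
Proof.
move=> P1 P2.
(* Either the reference speed tends to 0, or some level [e] is reached at arbitrarily late times, as
   [reference_speed_decay] requires. *)
have [small|/existsNP[e /not_implyP[e0 /forallNP big]]] :=
    pselect (forall e, 0 < e -> exists T : R, forall t, T <= t -> r i0 t < e).
  by left; split; [|apply: alternatives_exclusive]; exact: velocities_vanish.
right; have p2 : P2.
  apply/velocity_limit/(reference_speed_decay e0) => T _.
  have /existsNP[t /not_implyP[Tt /negP]] := big T.
  by rewrite -leNgt; exists t.
by split=> // p1; exact: alternatives_exclusive p2.
Qed.

End Dynamics.

Unset Implicit Arguments.

Theorem theorem3p3 (R : realType) (N n : nat) (m : 'I_N -> R) (sigma p kappa : R)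
    (phi : R -> R) (x v : 'I_N -> R -> 'rV[R]_n) (theta : 'I_N -> R -> R) :
  (1 <= N)%N -> (1 <= n)%N ->
  (forall i, 0 < m i) -> 0 < sigma -> 0 < p ->
  smooth phi ->
  (forall r, 0 <= r -> 0 < phi r) ->
  (forall r s, 0 <= r -> r <= s -> phi s <= phi r) ->
  (forall i, 0 < theta i 0) ->
  CSF_solution m sigma p kappa phi x v theta ->
  (* assumptions of Theorem 3.3 *)
  0 < kappa ->
  0 < inf (phi @` [set r | 0 <= r]) ->
  sigma * theta_bar m theta < inf (phi @` [set r | 0 <= r]) * total_mass m ->
  exp_decay (vel_diam v) /\
  (let P1 := forall i, enorm (v i t) @[t --> +oo] --> (0 : R) in
   let P2 := exists vb : 'rV[R]_n,
               enorm vb = theta_bar m theta `^ p^-1 /\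
               forall i, exp_decay (fun t => enorm (v i t - vb)) in
   (P1 /\ ~ P2) \/ (~ P1 /\ P2)).
Proof.
move=> N1 n1 m0 s0 p0 _ phi0 phi_dec th0 sol k0 inf0 gap.
(* The infimum serves as [phi_min]; positivity of [phi] bounds the image below, so [inf] is a true
   lower bound. *)
have phi_ge r : 0 <= r -> inf (phi @` [set r | 0 <= r]) <= phi r.
  by move=> r0; apply: ge_inf; [exists 0 => _ [s /phi0/ltW s0' <-]|exists r].
have phi_le r : 0 <= r -> phi r <= phi 0 by exact: phi_dec.
split; first exact: vel_diam_decay sol gap.
exact: velocity_dichotomy sol gap.
Qed.
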